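(* The class of string languages generated by string $\mathrm{MILL}1$ grammars is closed under intersection.
   Context: $\mathrm{MILL}1$ is first-order multiplicative intuitionistic linear logic (formulas from atoms $p(x_1,\dots,x_n)$ — no function symbols or constants — with $\otimes,\multimap,\exists,\forall$; standard sequent calculus with multiset antecedent and single succedent). $\mathrm{FVar}(A)$: free variables; $A[h]$: substitution. Fix two distinct variables $\mathbf{s},\mathbf{t}$. A string $\mathrm{MILL}1$ grammar is $\langle T,S,\triangleright\rangle$ with $T$ a finite alphabet, $S$ a formula with $\mathrm{FVar}(S)\subseteq\{\mathbf{s},\mathbf{t}\}$, $\triangleright\subseteq T\times\mathrm{Fm}$ a finite relation with $a\triangleright A\Rightarrow\mathrm{FVar}(A)\subseteq\{\mathbf{s},\mathbf{t}\}$. It generates the string $a_1\dots a_n$ ($n\ge0$) iff there are formulas $A_i$ with $a_i\triangleright A_i$ such that $A_1[x_0/\mathbf{s},x_1/\mathbf{t}],\dots,A_n[x_{n-1}/\mathbf{s},x_n/\mathbf{t}]\vdash S[x_0/\mathbf{s},x_n/\mathbf{t}]$ is derivable in $\mathrm{MILL}1$ for distinct variables $x_0,\dots,x_n$. *)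

(* Defs.v *)
From HB Require Import structures.
From mathcomp Require Import all_boot.
Set Implicit Arguments.
Unset Strict Implicit.
Unset Printing Implicit Defensive.

(* Formulas of first-order multiplicative intuitionistic linear logic.
   Variables are natural numbers, and bound variables are de
   Bruijn indices: below d quantifiers the index k < d denotes the variable
   bound by the k-th enclosing quantifier and the index k >= d denotes the free
   variable k - d.  Hence alpha-equivalent formulas are equal.  A predicate
   symbol is a name p : nat together with an arity, the latter being read off
   from the list of arguments: there are countably many symbols of each arity,
   and symbols of the same name but different arity are different. *)
Inductive form : Type :=
| Atom (p : nat) (xs : seq nat)
| Tens (A B : form)
| Lolli (A B : form)
| Ex (A : form)
| All (A : form).

Lemma form_comparable : comparable form.
Proof.
rewrite /comparable /decidable.
decide equality; [apply: (eq_comparable xs xs0) | apply: (eq_comparable p p0)].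
Qed.
HB.instance Definition _ := hasDecEq.Build form (compareP form_comparable).

Fixpoint fvar (A : form) : seq nat :=
  match A with
  | Atom _ xs => xs
  | Tens A B | Lolli A B => fvar A ++ fvar B
  | Ex A | All A => [seq x.-1 | x <- fvar A & x != 0]
  end.

Definition up (h : nat -> nat) (x : nat) : nat :=
  if x is x'.+1 then (h x').+1 else 0.

(* Capture-avoiding simultaneous replacement of each free variable x by h x. *)
Fixpoint subst (h : nat -> nat) (A : form) : form :=
  match A with
  | Atom p xs => Atom p (map h xs)
  | Tens A B => Tens (subst h A) (subst h B)
  | Lolli A B => Lolli (subst h A) (subst h B)
  | Ex A => Ex (subst (up h) A)
  | All A => All (subst (up h) A)
  end.

(* The instance A[y/x] of the body A of a quantified formula "exists x, A" or
   "forall x, A". *)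
Definition open (A : form) (y : nat) : form :=
  subst (fun x => if x is x'.+1 then x' else y) A.

Definition fresh (y : nat) (G : seq form) : bool :=
  all (fun A => y \notin fvar A) G.

(* The antecedent is a multiset: a list taken up to permutation, by [Exch]. *)
Inductive derivable : seq form -> form -> Prop :=
| Ax A : derivable [:: A] A
| Cut G D A C : derivable G A -> derivable (A :: D) C -> derivable (G ++ D) C
| Exch G D C : perm_eq G D -> derivable G C -> derivable D C
| TensL G A B C : derivable (A :: B :: G) C -> derivable (Tens A B :: G) C
| TensR G D A B :
    derivable G A -> derivable D B -> derivable (G ++ D) (Tens A B)
| LolliL G D A B C :
    derivable G A -> derivable (B :: D) C ->
    derivable (Lolli A B :: G ++ D) C
| LolliR G A B : derivable (A :: G) B -> derivable G (Lolli A B)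
| ExL G A C y :
    fresh y [:: Ex A, C & G] -> derivable (open A y :: G) C ->
    derivable (Ex A :: G) C
| ExR G A y : derivable G (open A y) -> derivable G (Ex A)
| AllL G A C y : derivable (open A y :: G) C -> derivable (All A :: G) C
| AllR G A y :
    fresh y (All A :: G) -> derivable G (open A y) -> derivable G (All A).

(* The two distinguished variables, and the substitution [x/s, y/t]. *)
Definition vs : nat := 0.
Definition vt : nat := 1.

Definition inst (A : form) (x y : nat) : form :=
  subst (fun v => if v == vs then x else if v == vt then y else v) A.

(* Symbols are drawn from an arbitrary type Sigma, so that grammars over
   different finite alphabets generate languages of the same type. *)
Record grammar (Sigma : eqType) := Grammar {
  alphabet : seq Sigma;
  start : form;
  lexicon : seq (Sigma * form);
  start_fvar : {subset fvar start <= [:: vs; vt]};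
  lexicon_alphabet : forall a A, (a, A) \in lexicon -> a \in alphabet;
  lexicon_fvar :
    forall a A, (a, A) \in lexicon -> {subset fvar A <= [:: vs; vt]}
}.

(* Derivability is invariant under injective renamings of the free variables,
   so it does not matter which distinct x_0, ..., x_n are considered. *)
Definition generates (Sigma : eqType) (G : grammar Sigma) (w : seq Sigma) :
    Prop :=
  exists A : 'I_(size w) -> form,
    (forall i, (tnth (in_tuple w) i, A i) \in lexicon G) /\
    (forall x : nat -> nat,
       (forall i j, i <= size w -> j <= size w -> x i = x j -> i = j) ->
       derivable [seq inst (A i) (x i) (x i.+1) | i <- enum 'I_(size w)]
                 (inst (start G) (x 0) (x (size w)))).

Definition mill1_language (Sigma : eqType) (L : seq Sigma -> Prop) : Prop :=
  exists G : grammar Sigma, forall w, L w <-> generates G w.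

(* Main.v *)
(* Rename the predicate symbols of the two grammars apart and give a symbol
   the types A (x) B, with A and B types assigned to it by the first and the
   second grammar; the start formula is S1 (x) S2.  The point is that, the two
   vocabularies being disjoint, a derivation of
   A_1 (x) B_1, ..., A_n (x) B_n |- S1 (x) S2 splits into derivations of
   A_1, ..., A_n |- S1 and B_1, ..., B_n |- S2.  Instead of eliminating cuts,
   formulas are interpreted in a phase model whose worlds are multisets of
   formulas tagged by one of the two vocabularies, an atom holding at the worlds
   that carry its own tag only and derive it.  By induction the same is then
   true of all formulas of a single vocabulary, and soundness of the model gives
   the splitting. *)
Require Import Defs.
From mathcomp Require Import all_boot zify.

Set Implicit Arguments.
Unset Strict Implicit.
Unset Printing Implicit Defensive.

(** * Substitution and fresh variables *)

Definition scons (y : nat) (r : nat -> nat) (x : nat) : nat :=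
  if x is x'.+1 then r x' else y.

Lemma mem_fvar_pred (A : form) (x : nat) :
  x.+1 \in fvar A -> x \in [seq z.-1 | z <- fvar A & z != 0].
Proof. by move=> xA; apply/mapP; exists x.+1; rewrite ?mem_filter. Qed.

Lemma eq_in_scons (A : form) (r r' : nat -> nat) (y : nat) :
  {in fvar (Ex A), r =1 r'} -> {in fvar A, scons y r =1 scons y r'}.
Proof. by move=> e [|x] //= xA; apply/e/mem_fvar_pred. Qed.

Lemma eq_in_subst (A : form) (h h' : nat -> nat) :
  {in fvar A, h =1 h'} -> subst h A = subst h' A.
Proof.
elim: A h h' => [p xs|A IA B IB|A IA B IB|A IA|A IA] h h' e /=.
- by congr Atom; apply/eq_in_map.
- by rewrite (IA _ h') ?(IB _ h') // => x xA; apply: e; rewrite mem_cat xA ?orbT.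
- by rewrite (IA _ h') ?(IB _ h') // => x xA; apply: e; rewrite mem_cat xA ?orbT.
- by rewrite (IA _ (up h')) // => -[|x] //= xA; rewrite e ?mem_fvar_pred.
- by rewrite (IA _ (up h')) // => -[|x] //= xA; rewrite e ?mem_fvar_pred.
Qed.

Lemma eq_subst (h h' : nat -> nat) : h =1 h' -> subst h =1 subst h'.
Proof. by move=> e A; apply: eq_in_subst => x _; apply: e. Qed.

Lemma subst_comp (A : form) (g h : nat -> nat) :
  subst g (subst h A) = subst (g \o h) A.
Proof.
elim: A g h => [p xs|A IA B IB|A IA B IB|A IA|A IA] g h /=.
- by rewrite map_comp.
- by rewrite IA IB.
- by rewrite IA IB.
- by rewrite IA; congr Ex; apply: eq_subst => -[].
- by rewrite IA; congr All; apply: eq_subst => -[].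
Qed.

Lemma subst_id (A : form) : subst id A = A.
Proof.
elim: A => [p xs|A IA B IB|A IA B IB|A IA|A IA] /=.
- by rewrite map_id.
- by rewrite IA IB.
- by rewrite IA IB.
- by rewrite -[in RHS]IA; congr Ex; apply: eq_subst => -[].
- by rewrite -[in RHS]IA; congr All; apply: eq_subst => -[].
Qed.

Lemma open_subst (A : form) (r : nat -> nat) (y : nat) :
  open (subst (up r) A) y = subst (scons y r) A.
Proof. by rewrite /open subst_comp; apply: eq_subst => -[]. Qed.

Lemma exists_fresh (G : seq form) : exists y, fresh y G.
Proof.
exists (\max_(x <- flatten (map fvar G)) x).+1.
apply/allP => A AG; apply/negP => yA.
have yG: (\max_(x <- flatten (map fvar G)) x).+1 \in flatten (map fvar G).
  by apply/flattenP; exists (fvar A); rewrite ?map_f.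
by have := @leq_bigmax_seq nat _ xpredT id _ yG isT; rewrite ltnn.
Qed.

(** * Renaming of predicate symbols *)

Section PredicateRenaming.

Variable f : nat -> nat.

Fixpoint ren (A : form) : form :=
  match A with
  | Atom p xs => Atom (f p) xs
  | Tens A B => Tens (ren A) (ren B)
  | Lolli A B => Lolli (ren A) (ren B)
  | Ex A => Ex (ren A)
  | All A => All (ren A)
  end.

Lemma fvar_ren (A : form) : fvar (ren A) = fvar A.
Proof. by elim: A => //= [A -> B ->|A -> B ->|A ->|A ->]. Qed.

Lemma ren_subst (h : nat -> nat) (A : form) : ren (subst h A) = subst h (ren A).
Proof.
by elim: A h => //= [A IA B IB|A IA B IB|A IA|A IA] h; rewrite ?IA ?IB.
Qed.

Lemma fresh_ren (y : nat) (G : seq form) : fresh y (map ren G) = fresh y G.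
Proof. by rewrite /fresh all_map; apply: eq_all => A /=; rewrite fvar_ren. Qed.

Lemma derivable_ren (G : seq form) (C : form) :
  derivable G C -> derivable (map ren G) (ren C).
Proof.
elim=> {G C} /=.
- by move=> A; apply: Ax.
- by move=> G D A C _ IG _ ID; rewrite map_cat; apply: Cut ID.
- by move=> G D C GD _; apply: Exch; apply: perm_map.
- by move=> G A B C _; apply: TensL.
- by move=> G D A B _ IG _; rewrite map_cat; apply: TensR.
- by move=> G D A B C _ IG _; rewrite map_cat; apply: LolliL.
- by move=> G A B _; apply: LolliR.
- move=> G A C y fy _; rewrite ren_subst => IG; apply: ExL IG.
  exact: etrans (fresh_ren y [:: Ex A, C & G]) fy.
- by move=> G A y _; rewrite ren_subst; apply: ExR.
- by move=> G A C y _; rewrite ren_subst; apply: AllL.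
- move=> G A y fy _; rewrite ren_subst => IG; apply: AllR IG.
  exact: etrans (fresh_ren y (All A :: G)) fy.
Qed.

End PredicateRenaming.

(** Iterates [TensL], in order to merge two antecedents position by position. The context [D] is
    arbitrary because the induction parks the two components of the head pair there. *)
Lemma derivable_tensl_zip (T : Type) (F G : T -> form) (s : seq T)
    (D : seq form) (C : form) :
  derivable (map F s ++ map G s ++ D) C ->
  derivable ([seq Tens (F i) (G i) | i <- s] ++ D) C.
Proof.
elim: s D => [//|i s IHs] D /= der; apply: TensL.
have: derivable ([seq Tens (F i) (G i) | i <- s] ++ F i :: G i :: D) C.
  apply: IHs; apply: Exch der.
  by apply/permP => a; rewrite /= !count_cat /= count_cat; lia.
apply: Exch.
exact/permEl/(perm_catCA _ [:: F i; G i]).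
Qed.

(** * Worlds and good sets of the phase model *)

(** The formulas in a world are not renamed: the tag alone records the vocabulary. *)
Definition world := seq (bool * form).

Definition proj (b : bool) (m : world) : seq form :=
  [seq x.2 | x <- m & x.1 == b].

Lemma proj_cat (b : bool) (m n : world) : proj b (m ++ n) = proj b m ++ proj b n.
Proof. by rewrite /proj filter_cat map_cat. Qed.

Lemma perm_proj (b : bool) (m n : world) :
  perm_eq m n -> perm_eq (proj b m) (proj b n).
Proof. by move=> mn; apply/perm_map/perm_filter. Qed.

(** The analogue of [good] for a single vocabulary, to be pulled back to worlds along a
    projection. *)
Definition fact (P : seq form -> Prop) : Prop :=
  [/\ forall s t, perm_eq s t -> P s -> P t,
      forall A B s, P (A :: B :: s) -> P (Tens A B :: s),
      forall A g s, derivable g A -> P (A :: s) -> P (g ++ s)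
    & forall A s, (forall y, P (open A y :: s)) -> P (Ex A :: s)].

(* The closed sets of the phase model are those stable under the left rules for
   the tensor and the existential, and under cut within one vocabulary; the
   other connectives preserve this class without further conditions. *)
Definition good (X : world -> Prop) : Prop :=
  [/\ forall m n, perm_eq m n -> X m -> X n,
      forall b A B m, X ((b, A) :: (b, B) :: m) -> X ((b, Tens A B) :: m),
      forall b A g m, proj (~~ b) g = [::] -> derivable (proj b g) A ->
        X ((b, A) :: m) -> X (g ++ m)
    & forall b A m, (forall y, X ((b, open A y) :: m)) -> X ((b, Ex A) :: m)].

Lemma fact_derivable (C : form) : fact (derivable^~ C).
Proof.
split=> [s t|A B s|A g s|A s].
- exact: Exch.
- exact: TensL.
- exact: Cut.
(* The closure condition offers all instances; a fresh one serves as eigenvariable. *)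
- by have [y fy] := exists_fresh [:: Ex A, C & s] => /(_ y); apply: ExL.
Qed.

(** Meant for the projection that [base] wants empty. Apart from permutation, the conditions are
    vacuous: their premises equate a nonempty list with [[::]]. *)
Lemma fact_nil : fact (eq^~ [::]).
Proof. by split=> // [s t + s0|A s /(_ 0)//]; rewrite s0 perm_sym => /perm_nilP. Qed.

(** A step at tag [c] is the same step on the projection to [c] and is invisible in the other
    projection; for cut, the latter is the condition that [g] carries no other tag. *)
Lemma good_proj (P : seq form -> Prop) (b : bool) :
  fact P -> good (fun m => P (proj b m)).
Proof.
case=> Pperm Ptens Pcut Pex; split=> [m n mn|c A B m|c A g m gNb gA|c A m].
- exact/Pperm/perm_proj.
- by rewrite /proj /=; case: eqP => // _; apply: Ptens.
- rewrite proj_cat /proj /= -!/(proj _ _); case: eqP => [<-|/eqP ncb].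
    exact: Pcut gA.
  suff ->: b = ~~ c by rewrite gNb.
  by move: ncb; case: (b); case: (c).
- by rewrite /proj /=; case: eqP => [_ /Pex|_ /(_ 0)].
Qed.

Lemma good_and (X Y : world -> Prop) :
  good X -> good Y -> good (fun m => X m /\ Y m).
Proof.
case=> Xp Xt Xc Xe [Yp Yt Yc Ye]; split.
- by move=> m n mn [/(Xp _ _ mn) ? /(Yp _ _ mn)].
- by move=> b A B m [/Xt ? /Yt].
- by move=> b A g m g0 gA [/(Xc _ _ _ _ g0 gA) ? /(Yc _ _ _ _ g0 gA)].
- by move=> b A m H; split; [apply: Xe => y; case: (H y)|apply: Ye => y; case: (H y)].
Qed.

Lemma good_forall (T : Type) (X : T -> world -> Prop) :
  (forall i, good (X i)) -> good (fun m => forall i, X i m).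
Proof.
move=> gX; split.
- by move=> m n mn H i; have [Xp _ _ _] := gX i; apply: Xp mn (H i).
- by move=> b A B m H i; have [_ Xt _ _] := gX i; apply: Xt (H i).
- by move=> b A g m g0 gA H i; have [_ _ Xc _] := gX i; apply: Xc g0 gA (H i).
- by move=> b A m H i; have [_ _ _ Xe] := gX i; apply: Xe => y; apply: H.
Qed.

(** The denotation of a linear implication is an intersection of such shifts. *)
Lemma good_shift (X : world -> Prop) (n : world) :
  good X -> good (fun m => X (n ++ m)).
Proof.
case=> Xp Xt Xc Xe.
have mv x m : perm_eq (n ++ x :: m) (x :: n ++ m).
  by rewrite perm_catC /= perm_cons perm_catC.
have vm x m : perm_eq (x :: n ++ m) (n ++ x :: m) by rewrite perm_sym mv.
split.
- by move=> m m' mm'; apply: Xp; rewrite perm_cat2l.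
- move=> b A B m H; apply/(Xp _ _ (vm _ _))/Xt; apply: Xp H.
  by apply: perm_trans (mv _ _) _; rewrite perm_cons mv.
- move=> b A g m g0 gA /(Xp _ _ (mv _ _)) /(Xc _ _ _ _ g0 gA).
  by apply: Xp; rewrite perm_catCA.
- move=> b A m H; apply/(Xp _ _ (vm _ _))/Xe => y.
  exact: Xp (mv _ _) (H y).
Qed.

Lemma good_shiftr (X : world -> Prop) (n : world) :
  good X -> good (fun m => X (m ++ n)).
Proof.
move=> gX; have [Sp St Sc Se] := good_shift n gX; have [Xp _ _ _] := gX.
have c m : X (m ++ n) <-> X (n ++ m) by split; apply: Xp; rewrite perm_catC.
split.
- by move=> m m' mm' /c /(Sp _ _ mm') /c.
- by move=> b A B m /c /St /c.
- by move=> b A g m g0 gA /c /(Sc _ _ _ _ g0 gA) /c.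
- by move=> b A m H; apply/c/Se => y; apply/c.
Qed.

(** * Denotations of formulas *)

Definition base (b : bool) (C : form) (m : world) : Prop :=
  proj (~~ b) m = [::] /\ derivable (proj b m) C.

Lemma good_base (b : bool) (C : form) : good (base b C).
Proof.
apply: good_and; first exact: good_proj fact_nil.
exact: (good_proj _ (fact_derivable C)).
Qed.

Lemma base_ax (b : bool) (A : form) : base b A [:: (b, A)].
Proof. by rewrite /base /proj /= eqxx; case: b; split=> //; apply: Ax. Qed.

(* Even predicate symbols belong to the vocabulary tagged [false] and odd ones
   to the one tagged [true]; [p./2] is the symbol before renaming.  The tensor
   and the existential denote the least good set with the required elements. *)
Fixpoint interp (A : form) (r : nat -> nat) (m : world) : Prop :=
  match A with
  | Atom p xs => base (odd p) (Atom p./2 (map r xs)) m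
  | Tens A B => forall X, good X ->
      (forall a b, interp A r a -> interp B r b -> X (a ++ b)) -> X m
  | Lolli A B => forall a, interp A r a -> interp B r (a ++ m)
  | Ex A => forall X, good X ->
      (forall y a, interp A (scons y r) a -> X a) -> X m
  | All A => forall y, interp A (scons y r) m
  end.

Lemma good_interp (A : form) (r : nat -> nat) : good (interp A r).
Proof.
elim: A r => [p xs|A IA B IB|A IA B IB|A IA|A IA] r /=.
- exact: good_base.
(* A least good set is an intersection of good sets [X], indexed by [X], by a proof that it is good
   and by a proof that it contains the generators. *)
- by do 3![apply: good_forall => ?].
- by apply: good_forall => a; apply: good_forall => _; apply: good_shift.
- by do 3![apply: good_forall => ?].
- by apply: good_forall => y.
Qed.

Lemma perm_interp (A : form) (r : nat -> nat) (m n : world) :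
  perm_eq m n -> interp A r m -> interp A r n.
Proof. by case: (good_interp A r) => H _ _ _; apply: H. Qed.

Lemma interp_eq_in (A : form) (r r' : nat -> nat) (m : world) :
  {in fvar A, r =1 r'} -> interp A r m -> interp A r' m.
Proof.
elim: A r r' m => [p xs|A IA B IB|A IA B IB|A IA|A IA] r r' m e /=.
- by move/eq_in_map: e => ->.
- have eA: {in fvar A, r' =1 r} by move=> x xA; rewrite e //= mem_cat xA.
  have eB: {in fvar B, r' =1 r} by move=> x xB; rewrite e //= mem_cat xB orbT.
  by move=> H X gX HX; apply: H => // a b /(IA _ r') Ha /(IB _ r') Hb; apply: HX;
    [apply: Ha => x /eA ->|apply: Hb => x /eB ->].
- have eA: {in fvar A, r' =1 r} by move=> x xA; rewrite e //= mem_cat xA.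
  have eB: {in fvar B, r =1 r'} by move=> x xB; rewrite e //= mem_cat xB orbT.
  by move=> H a /(IA _ _ _ eA) /H; apply: IB.
- move=> H X gX HX; apply: H => // y a Ha; apply: (HX y); apply: IA Ha.
  exact: eq_in_scons.
- by move=> H y; apply: IA (H y); apply: eq_in_scons.
Qed.

Lemma interp_subst (A : form) (h r : nat -> nat) (m : world) :
  interp (subst h A) r m <-> interp A (r \o h) m.
Proof.
have sup y s : scons y s \o up h =1 scons y (s \o h) by case.
elim: A h r m sup => [p xs|A IA B IB|A IA B IB|A IA|A IA] h r m sup /=.
- by rewrite map_comp.
- by split=> H X gX HX; apply: H => // a b /IA Ha /IB Hb; apply: HX; auto.
- by split=> H a Ha; apply/(IB h)=> //; apply/H/(IA h).
- have E y a : interp (subst (up h) A) (scons y r) a <->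
               interp A (scons y (r \o h)) a.
    rewrite IA; last by move=> z s [].
    by split; apply: interp_eq_in => x _; rewrite sup.
  by split=> H X gX HX; apply: H => // y a /E; apply: HX.
- have E y a : interp (subst (up h) A) (scons y r) a <->
               interp A (scons y (r \o h)) a.
    rewrite IA; last by move=> z s [].
    by split; apply: interp_eq_in => x _; rewrite sup.
  by split=> H y; apply/E.
Qed.

Lemma interp_open (A : form) (r : nat -> nat) (y : nat) (m : world) :
  interp (open A y) r m <-> interp A (scons (r y) r) m.
Proof. by rewrite interp_subst; split; apply: interp_eq_in => -[]. Qed.

(** * Soundness of the model *)

Fixpoint interps (G : seq form) (r : nat -> nat) (m : world) : Prop :=
  if G is A :: G' then
    exists a n, [/\ interp A r a, interps G' r n & m = a ++ n]
  else m = [::].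

Lemma interps_cat (G D : seq form) (r : nat -> nat) (m : world) :
  interps (G ++ D) r m <->
  exists g d, [/\ interps G r g, interps D r d & m = g ++ d].
Proof.
elim: G m => [|A G IG] m /=.
  by split=> [H|[g [d [-> H ->]]]] //; exists [::], m.
split.
- case=> a [n [Ha /IG [g [d [Hg Hd ->]]] ->]].
  by exists (a ++ g), d; split; rewrite ?catA //; exists a, g.
- case=> _ [d [[a [g [Ha Hg ->]]] Hd ->]].
  exists a, (g ++ d); split; rewrite ?catA //.
  by apply/IG; exists g, d.
Qed.

Lemma interps_eq_in (G : seq form) (r r' : nat -> nat) (m : world) :
  (forall A, A \in G -> {in fvar A, r =1 r'}) ->
  interps G r m -> interps G r' m.
Proof.
elim: G m => [//|A G IG] m e /= [a [n [Ha Hn ->]]].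
exists a, n; split=> //.
  by apply: interp_eq_in Ha; apply: e; rewrite mem_head.
by apply: IG Hn => B BG; apply: e; rewrite in_cons BG orbT.
Qed.

Lemma fresh_update (y z : nat) (r : nat -> nat) (G : seq form) (A : form) :
  fresh y G -> A \in G -> {in fvar A, r =1 [eta r with y |-> z]}.
Proof.
move=> /allP fy AG x xA /=; case: eqP => // exy.
by move: (fy A AG); rewrite -exy xA.
Qed.

(** A quantifier rule supplies one eigenvariable [y], while the denotation ranges over all values
    [z]. Freshness allows the valuation to be changed at [y] to any [z]. *)
Lemma interp_open_update (A : form) (r : nat -> nat) (y z : nat) (m : world) :
  y \notin fvar (Ex A) ->
  interp (open A y) [eta r with y |-> z] m <-> interp A (scons z r) m.
Proof.
move=> yA; rewrite interp_open /= eqxx.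
have e: {in fvar A, scons z r =1 scons z [eta r with y |-> z]}.
  apply: eq_in_scons; apply: (@fresh_update _ _ _ [:: Ex A]); last exact: mem_head.
  by rewrite /fresh /= andbT.
by split; apply: interp_eq_in => x /e ->.
Qed.

Lemma soundness (G : seq form) (C : form) :
  derivable G C -> forall r m, interps G r m -> interp C r m.
Proof.
elim=> {G C}.
- by move=> A r m /= [a [n [Ha -> ->]]]; rewrite cats0.
- move=> G D A C _ IG _ ID r m /interps_cat [g [d [/IG Hg Hd ->]]].
  by apply: ID => /=; exists g, d.
- move=> G D C GD _; move: G D GD.
  (* Permutations are generated by swaps of adjacent blocks. *)
  apply: catCA_perm_ind => s1 s2 s3 IG r m.
  case/interps_cat=> n2 [_ [H2 /interps_cat [n1 [n3 [H1 H3 ->]]] ->]].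
  apply: (@perm_interp _ _ (n1 ++ n2 ++ n3)); first by rewrite perm_catCA.
  apply: IG; apply/interps_cat; exists n1, (n2 ++ n3); split=> //.
  by apply/interps_cat; exists n2, n3.
- move=> G A B C _ IG r m /= [t [n [Ht Hn ->]]].
  (* As [t] is in a least good set, it suffices to treat its generators [a ++ b]: the worlds that
     satisfy [C] when followed by [n] form a good set. *)
  apply: (Ht (fun t => interp C r (t ++ n))); first exact/good_shiftr/good_interp.
  move=> a b Ha Hb; rewrite -catA; apply: IG => /=.
  by exists a, (b ++ n); split=> //; exists b, n.
- move=> G D A B _ IG _ ID r m /interps_cat [g [d [/IG Hg /ID Hd ->]]].
  by move=> /= X _; apply.
- move=> G D A B C _ IG _ ID r m /= [l [_ [Hl /interps_cat [g [d [/IG Hg Hd ->]]] ->]]].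
  apply: (@perm_interp _ _ ((g ++ l) ++ d)); first by rewrite -catA perm_catCA.
  by apply: ID => /=; exists (g ++ l), d; split=> //; apply: Hl.
- by move=> G A B _ IG r m Hm /= a Ha; apply: IG => /=; exists a, m.
- move=> G A C y fy _ IG r m /= [e [n [He Hn ->]]].
  apply: (He (fun e => interp C r (e ++ n))); first exact/good_shiftr/good_interp.
  move=> z a Ha.
  have frC: {in fvar C, [eta r with y |-> z] =1 r}.
    by move=> x xC; rewrite (fresh_update z r fy (A := C)) // !inE eqxx orbT.
  apply: (interp_eq_in frC); apply: IG => /=; exists a, n; split=> //.
    by apply/interp_open_update => //; case/andP: fy.
  apply: interps_eq_in Hn => B BG; apply: (fresh_update _ _ fy).
  by rewrite !inE BG !orbT.
- by move=> G A y _ IG r m /IG /interp_open Hm X _ HX; apply: HX Hm.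
- move=> G A C y _ IG r m /= [a [n [Ha Hn ->]]].
  by apply: IG; exists a, n; split=> //; apply/interp_open.
- move=> G A y fy _ IG r m Hm /= z; apply/(@interp_open_update _ _ y).
    by case/andP: fy.
  apply: IG; apply: interps_eq_in Hm => B BG; apply: (fresh_update _ _ fy).
  by rewrite inE BG orbT.
Qed.

(** * Splitting and joining derivations *)

Definition tag (b : bool) : form -> form := ren (fun p => b + p.*2).

(** From left to right, least good sets are tested against [base] and the right rules apply.
    Conversely, the left rules come from the closure of good sets for [Tens] and [Ex], and from cuts
    for [Lolli] and [All]. *)
Lemma interp_tag (b : bool) (A : form) (r : nat -> nat) (m : world) :
  interp (tag b A) r m <-> base b (subst r A) m.
Proof.
elim: A r m => [p xs|A IA B IB|A IA B IB|A IA|A IA] r m /=.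
- by rewrite oddD odd_double addbF half_bit_double oddb.
- split=> [H|H X gX HX].
  + apply: H; first exact: good_base.
    move=> a c /IA [a0 aA] /IB [c0 cB].
    by rewrite /base !proj_cat a0 c0; split=> //; apply: TensR.
  + have [_ Xt Xc _] := gX; case: H => m0 mAB.
    (* Closure under cut replaces [m] by the tensor alone, which splits into its two components,
       each forcing its own formula. *)
    rewrite -[m]cats0; apply: (Xc _ _ _ _ m0 mAB); apply: Xt.
    by apply: (HX [:: _] [:: _]); [apply/IA|apply/IB]; apply: base_ax.
- split=> [H|[m0 mAB] a /IA [a0 aA]].
  (* The implication is tested at the world consisting of its premise alone. *)
  + have /H /IB := (IA r [:: (b, subst r A)]).2 (base_ax _ _).
    rewrite /base /proj /= eqxx; case: (b) => -[m0 mB]; split=> //; exact: LolliR.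
  + apply/IB; rewrite /base !proj_cat a0 m0; split=> //.
    apply: (@Exch (proj b m ++ proj b a ++ [::])); first by rewrite cats0 perm_catC.
    apply: Cut mAB _; apply: LolliL aA _; exact: Ax.
- split=> [H|[m0 mA] X gX HX].
  + apply: H; first exact: good_base.
    move=> y a /IA [a0 aA]; split=> //; apply: (@ExR _ _ y).
    by rewrite open_subst.
  + have [_ _ Xc Xe] := gX.
    rewrite -[m]cats0; apply: (Xc _ _ _ _ m0 mA); apply: Xe => y.
    by apply: (HX y); apply/IA; rewrite open_subst; apply: base_ax.
- split=> [H|[m0 mA] y].
  (* Any instance excludes the other tag; derivability takes a fresh one, for [AllR]. *)
  + split; first by case/IA: (H 0).
    have [y fy] := exists_fresh (All (subst (up r) A) :: proj b m).
    by apply: AllR fy _; rewrite open_subst; case/IA: (H y).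
  + apply/IA; split=> //; rewrite -[proj b m]cats0; apply: Cut mA _.
    by apply: (@AllL _ _ _ y); rewrite open_subst; apply: Ax.
Qed.

Lemma tens_tag_inv (T : Type) (F G : T -> form) (s : seq T) (C D : form) :
  derivable [seq Tens (tag false (F i)) (tag true (G i)) | i <- s]
    (Tens (tag false C) (tag true D)) ->
  derivable (map F s) C /\ derivable (map G s) D.
Proof.
move/soundness/(_ id).
(* Each tensor of the antecedent contributes its two components, with their tags. *)
pose n := flatten [seq [:: (false, F i); (true, G i)] | i <- s].
have n_s: interps [seq Tens (tag false (F i)) (tag true (G i)) | i <- s] id n.
  rewrite /n; elim: s {n} => [//|i s IHs] /=.
  exists [:: (false, F i); (true, G i)]; eexists; split; [|exact: IHs|by []].
  move=> X _ HX; apply: (HX [:: _] [:: _]); apply/interp_tag; rewrite subst_id;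
    exact: base_ax.
have [nF nG]: proj false n = map F s /\ proj true n = map G s.
  by rewrite /n; elim: s {n n_s} => [//|i s [IF IG]]; rewrite /proj /= -!/(proj _ _) IF IG.
(* The succedent denotes a least good set; it is tested against the worlds whose two projections
   derive [C] and [D]. *)
move/(_ _ n_s)/(_ (fun m => derivable (proj false m) C /\ derivable (proj true m) D)).
rewrite nF nG; apply.
  by apply: good_and; apply: (good_proj _ (fact_derivable _)).
move=> a b /interp_tag + /interp_tag.
rewrite !subst_id => -[/= a0 aC] [/= b0 bD]; rewrite !proj_cat a0 b0 cats0.
by split.
Qed.

Lemma tens_tag (T : Type) (F G : T -> form) (s : seq T) (C D : form) :
  derivable (map F s) C -> derivable (map G s) D ->
  derivable [seq Tens (tag false (F i)) (tag true (G i)) | i <- s]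
    (Tens (tag false C) (tag true D)).
Proof.
move=> sC sD; rewrite -[X in derivable X]cats0; apply: derivable_tensl_zip.
rewrite cats0 (map_comp (tag false) F) (map_comp (tag true) G).
by apply: TensR; apply: derivable_ren.
Qed.

(** * The grammar of the intersection *)

Section Intersection.

Variables (Sigma : eqType) (G H : grammar Sigma).

Definition tens_start : form := Tens (tag false (start G)) (tag true (start H)).

Definition tens_lexicon : seq (Sigma * form) :=
  [seq (p.1, Tens (tag false p.2) (tag true q.2))
     | p <- lexicon G, q <- [seq q <- lexicon H | q.1 == p.1]].

Lemma tens_lexiconP (a : Sigma) (C : form) :
  reflect (exists AB : form * form,
             [/\ (a, AB.1) \in lexicon G, (a, AB.2) \in lexicon H
               & C = Tens (tag false AB.1) (tag true AB.2)])
          ((a, C) \in tens_lexicon).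
Proof.
apply: (iffP allpairsPdep) => [[[a1 A] [[a2 B] [/= aA]]]|[[A B] [/= aA aB ->]]].
  by rewrite mem_filter /= => /andP [/eqP -> aB] [-> ->]; exists (A, B).
by exists (a, A), (a, B); rewrite mem_filter /= eqxx.
Qed.

Lemma fvar_tens_tag (A B : form) (s : seq nat) :
  {subset fvar A <= s} -> {subset fvar B <= s} ->
  {subset fvar (Tens (tag false A) (tag true B)) <= s}.
Proof. by move=> As Bs x /=; rewrite mem_cat !fvar_ren => /orP [/As|/Bs]. Qed.

Lemma tens_start_fvar : {subset fvar tens_start <= [:: vs; vt]}.
Proof. by apply: fvar_tens_tag; apply: start_fvar. Qed.

Lemma tens_lexicon_alphabet (a : Sigma) (C : form) :
  (a, C) \in tens_lexicon -> a \in alphabet G.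
Proof. by case/tens_lexiconP => AB [/lexicon_alphabet]. Qed.

Lemma tens_lexicon_fvar (a : Sigma) (C : form) :
  (a, C) \in tens_lexicon -> {subset fvar C <= [:: vs; vt]}.
Proof.
by case/tens_lexiconP => AB [/lexicon_fvar ? /lexicon_fvar ? ->]; apply: fvar_tens_tag.
Qed.

Definition tens_grammar : grammar Sigma :=
  Grammar tens_start_fvar tens_lexicon_alphabet tens_lexicon_fvar.

Lemma inst_tens_tag (A B : form) (x y : nat) :
  inst (Tens (tag false A) (tag true B)) x y =
  Tens (tag false (inst A x y)) (tag true (inst B x y)).
Proof. by rewrite /inst /tag !ren_subst. Qed.

Lemma generates_tens_grammar (w : seq Sigma) :
  generates tens_grammar w <-> generates G w /\ generates H w.
Proof.
split=> [[C [wC derC]]|[[A [wA derA]] [B [wB derB]]]].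
  (* Finite choice over the positions fixes both components before the variables [x] are given, as
     [generates] demands. *)
  have /fin_all_exists [AB HAB] i := tens_lexiconP _ _ (wC i).
  have dec x : (forall i j, i <= size w -> j <= size w -> x i = x j -> i = j) ->
      derivable [seq inst (AB i).1 (x i) (x i.+1) | i <- enum 'I_(size w)]
                (inst (start G) (x 0) (x (size w))) /\
      derivable [seq inst (AB i).2 (x i) (x i.+1) | i <- enum 'I_(size w)]
                (inst (start H) (x 0) (x (size w))).
    move/derC => derx; apply: tens_tag_inv; move: derx.
    rewrite [inst _ _ _]inst_tens_tag; congr derivable; apply: eq_map => i.
    by have [_ _ ->] := HAB i; rewrite inst_tens_tag.
  by split; [exists (fun i => (AB i).1)|exists (fun i => (AB i).2)];
    split=> [i|x /dec []//]; case: (HAB i).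
exists (fun i => Tens (tag false (A i)) (tag true (B i))); split=> [i|x inj_x].
  by apply/tens_lexiconP; exists (A i, B i).
rewrite [inst (start _) _ _]inst_tens_tag (eq_map (fun i => inst_tens_tag _ _ _ _)).
exact: tens_tag (derA x inj_x) (derB x inj_x).
Qed.

End Intersection.

Theorem theorem29 (Sigma : eqType) (L1 L2 : seq Sigma -> Prop) :
  mill1_language L1 -> mill1_language L2 ->
  mill1_language (fun w => L1 w /\ L2 w).
Proof.
move=> [G1 L1G] [G2 L2G]; exists (tens_grammar G1 G2) => w.
by rewrite generates_tens_grammar L1G L2G.
Qed.
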